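(* Let $D$ be a directed graph on $[n]$ (loops allowed). The following are equivalent: (a) $\mathrm{crank}[D]=2^n$; (b) $\mathrm{minrank}[D,2]=2^n$; (c) $\mathrm{minrank}[D]=2^n$; (d) $D$ is a disjoint union of (directed) cycles; (e) $\mathrm{C}(D)$ has $n$ connected components, each isomorphic to $\vec P_1$, the directed path with one arc.
   Context: For $q\ge2$, $\langle q\rangle=\{0,\dots,q-1\}$. For $f:\langle q\rangle^n\to\langle q\rangle^n$, $\mathrm{IG}(f)$ is the graph on $[n]$ with an arc $uv$ iff there exist $a,b$ differing only in coordinate $u$ with $f_v(a)\ne f_v(b)$; $F[D,q]=\{f:\mathrm{IG}(f)=D\}$; $\operatorname{rank}(f)$ is the number of images of $f$; $\mathrm{minrank}[D,q]=\min_{f\in F[D,q]}\operatorname{rank}(f)$, $\mathrm{minrank}[D]=\min_{q\ge 2}\mathrm{minrank}[D,q]$. The conjunctive network on $D$ is $f:\{0,1\}^n\to\{0,1\}^n$ with $f_v(x)=\bigwedge_{u\in N^-(v)}x_u$ (empty conjunction equal to $1$), and $\mathrm{crank}[D]$ is its rank. A disjoint union of cycles means every vertex has in-degree and out-degree exactly one (loops count as cycles of length one). Canonical version $\mathrm{C}(D)$ (vertices of $D$ ordered as integers): (1) $D'$ has vertex set $V_0\cup V_1$, $V_i=\{v_i: v\in[n]\}$, and arcs $\{u_0v_1: uv \text{ an arc of } D\}$; (2) $v_1\in V_1$ is redundant if there exists $S\subseteq V_1\setminus\{v_1\}$ with $N^-(S)=N^-(v_1)$ in $D'$ and such that if $S$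 contains exactly one non-isolated vertex $u_1$ then $u<v$; $D''$ is $D'$ minus all redundant vertices of $V_1$; (3) $v_0\in V_0$ is redundant in $D''$ if it is isolated in $D''$ or there is $u<v$ with $N^+(u_0)=N^+(v_0)$ in $D''$; $\mathrm{C}(D)$ is $D''$ minus these redundant vertices. Here $N^-(S)=\bigcup_{s\in S}N^-(s)$. *)

(* Defs.v *)
From HB Require Import structures.
From mathcomp Require Import boolp classical_sets.
From mathcomp Require Import all_boot.
Set Implicit Arguments.
Unset Strict Implicit.
Unset Printing Implicit Defensive.

(* The default 0 (for the empty set) is never reached below: see
   [has_network_nonempty]. *)
Definition nat_min (A : set nat) : nat :=
  xget 0 [set m | A m /\ forall k, A k -> m <= k]%classic.

Lemma nat_minP (A : set nat) :
  (A !=set0)%classic -> A (nat_min A) /\ forall k, A k -> nat_min A <= k.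
Proof.
move=> [a Aa].
have exA : exists m, `[< A m >] by exists a; apply/asboolP.
case: (ex_minnP exA) => m /asboolP Am minm.
have P : (A m /\ forall k, A k -> m <= k) by split=> // k /asboolP; exact: minm.
by rewrite /nat_min; case: xgetP => [x _ //|/(_ m)].
Qed.

Definition config (n q : nat) := {ffun 'I_n -> 'I_q}.

Definition interaction_graph (n q : nat) (f : config n q -> config n q) :
    rel 'I_n :=
  fun u v => [exists a : config n q, [exists b : config n q,
    [forall w, (a w != b w) == (w == u)] && (f a v != f b v)]].

Definition has_network (n : nat) (D : rel 'I_n) (q : nat) :
    set (config n q -> config n q) :=
  [set f | forall u v, interaction_graph f u v = D u v]%classic.
Arguments has_network {n} D q _.

Definition rank (n q : nat) (f : config n q -> config n q) : nat :=
  #|codom f|.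

Definition minrankq (n : nat) (D : rel 'I_n) (q : nat) : nat :=
  nat_min [set rank f | f in has_network D q]%classic.

Definition minrank (n : nat) (D : rel 'I_n) : nat :=
  nat_min [set minrankq D q | q in [set q | 2 <= q]]%classic.

(* In 'I_2, [ord_max] is 1 and [ord0] is 0. *)
Definition conj_network (n : nat) (D : rel 'I_n) (x : config n 2) :
    config n 2 :=
  [ffun v => if [forall (u | D u v), x u == ord_max] then ord_max else ord0].

Definition crank (n : nat) (D : rel 'I_n) : nat := rank (conj_network D).

Lemma has_network_nonempty (n : nat) (D : rel 'I_n) (q : nat) :
  2 <= q -> (has_network D q !=set0)%classic.
Proof.
case: q => [|[|q]] // _.
pose i0 : 'I_q.+2 := ord0; pose i1 : 'I_q.+2 := lift ord0 ord0.
exists (fun x : config n q.+2 =>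
  [ffun v => if [forall (u | D u v), x u == i1] then i1 else i0]) => u v.
apply/existsP/idP => [[a /existsP[b /andP[/forallP ab]]]|Duv].
  rewrite !ffunE; apply: contraNT => nD.
  suff -> : [forall (w | D w v), a w == i1] = [forall (w | D w v), b w == i1] by [].
  apply: eq_forallb => w; case Dw: (D w v) => //=.
  have := ab w; case: (w =P u) => [wu|_]; first by rewrite -wu Dw in nD.
  by rewrite eqbF_neg negbK => /eqP ->.
exists [ffun=> i1]; apply/existsP; exists [ffun w => if w == u then i0 else i1].
apply/andP; split.
  by apply/forallP => w; rewrite !ffunE; case: (w == u).
rewrite !ffunE; case: ifP => [_|/negP[]]; last first.
  by apply/forallP => w; rewrite ffunE eqxx implybT.
by case: ifP => // /forallP/(_ u); rewrite Duv /= ffunE eqxx.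
Qed.

Definition disjoint_union_of_cycles (n : nat) (D : rel 'I_n) : Prop :=
  forall v : 'I_n, #|[set u | D u v]| = 1 /\ #|[set w | D v w]| = 1.

Record digraph := Digraph { vertex :> finType; arc : rel vertex }.

Section Digraph.
Variable G : digraph.

Definition in_nbr (x : G) : {set G} := [set y | arc y x].
Definition out_nbr (x : G) : {set G} := [set y | arc x y].
Definition in_nbrs (S : {set G}) : {set G} := \bigcup_(s in S) in_nbr s.
Definition isolated (x : G) : bool :=
  (in_nbr x == set0) && (out_nbr x == set0).

Definition remove (R : {set G}) : digraph :=
  @Digraph {x : G | x \notin R} (fun x y => arc (val x) (val y)).

Definition components : {set {set G}} :=
  equivalence_partition (connect (fun x y => arc x y || arc y x)) [set: G].

Definition component_graph (K : {set G}) : digraph := remove (~: K).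

End Digraph.

Definition isomorphic (G H : digraph) : Prop :=
  exists2 h : G -> H, bijective h & forall x y, arc (h x) (h y) = arc x y.

(* k counts the arcs. *)
Definition dipath (k : nat) : digraph :=
  @Digraph 'I_k.+1 (fun i j => j == i.+1 :> nat).

Section Canonical.
Variables (n : nat) (D : rel 'I_n).

(* D': [inl v] is v_0 and [inr v] is v_1. *)
Definition bipartite : digraph :=
  @Digraph ('I_n + 'I_n)%type
    (fun x y => match x, y with inl u, inr v => D u v | _, _ => false end).

Definition v1 (v : 'I_n) : bipartite := inr v.

Definition redundant1 (v : 'I_n) : bool :=
  [exists S : {set bipartite},
    [&& S \subset [set v1 w | w : 'I_n] :\ v1 v,
        in_nbrs S == in_nbr (v1 v) &
        [forall u : 'I_n,
          ([set s in S | ~~ isolated s] == [set v1 u]) ==> (u < v)]]].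

(* D'' *)
Definition bipartite_reduced : digraph :=
  remove [set v1 v | v : 'I_n & redundant1 v].

(* The equation [val x = inl v] says that the vertex x of D'' is v_0. *)
Definition redundant0 (x : bipartite_reduced) : bool :=
  [exists v : 'I_n, (val x == inl v) &&
    (isolated x ||
     [exists y : bipartite_reduced, [exists u : 'I_n,
       [&& val y == inl u, u < v & out_nbr y == out_nbr x]]])].

Definition canonical_version : digraph :=
  remove [set x : bipartite_reduced | redundant0 x].

End Canonical.

(* Main.v *)
(* If the conjunctive network is onto, then each v has an in-neighbour whose
   only out-neighbour is v, so D is the graph of a permutation s.  Conversely,
   if D is the graph of s, each f_v depends only on x_{s v} and takes at least
   two values; as s is a permutation these can be chosen independently, so
   rank f >= 2^n over every alphabet.
   For the canonical version: all components of a digraph are P_1 iff every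
   vertex has in-degree plus out-degree 1.  This makes n components of type P_1
   account for 2n vertices, so nothing was removed from the bipartite graph D',
   whose degrees are the in- and out-degrees of D. *)

From mathcomp Require Import boolp classical_sets.
From mathcomp Require Import all_boot.
Require Import Defs.
Set Implicit Arguments.
Unset Strict Implicit.
Unset Printing Implicit Defensive.

(** * Bounds on ranks and attainment of the minima *)

Lemma rank_le (n q : nat) (f : config n q -> config n q) : rank f <= q ^ n.
Proof.
by rewrite (leq_trans (max_card _)) // card_ffun !card_ord.
Qed.

Lemma rank_full_surj (n q : nat) (f : config n q -> config n q) :
  rank f = q ^ n -> forall y, exists x, y = f x.
Proof.
move=> rf y; apply/codomP.
have /subset_cardP : #|codom f| = #|config n q|.
  by rewrite -/(rank f) rf card_ffun !card_ord.
by move=> /(_ (subset_predT _)) ->.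
Qed.

Lemma conj_network_has (n : nat) (D : rel 'I_n) :
  has_network D 2 (conj_network D).
Proof.
move=> u v.
apply/existsP/idP => [[a /existsP[b /andP[/forallP ab]]]|Duv].
  rewrite !ffunE; apply: contraNT => nD.
  suff -> : [forall (w | D w v), a w == ord_max] =
            [forall (w | D w v), b w == ord_max] by [].
  apply: eq_forallb => w; case Dw: (D w v) => //=.
  have := ab w; case: (w =P u) => [wu|_]; first by rewrite -wu Dw in nD.
  by rewrite eqbF_neg negbK => /eqP ->.
(* Switching [u] to 0 in the all-ones configuration breaks every conjunction that reads [u]. *)
exists [ffun=> ord_max]; apply/existsP.
exists [ffun w => if w == u then ord0 else ord_max].
apply/andP; split.
  by apply/forallP => w; rewrite !ffunE; case: (w == u).
rewrite !ffunE; case: ifP => [_|/negP[]]; last first.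
  by apply/forallP => w; rewrite ffunE eqxx implybT.
by case: ifP => // /forallP/(_ u); rewrite Duv /= ffunE eqxx.
Qed.

Lemma minrankqP (n : nat) (D : rel 'I_n) (q : nat) : 2 <= q ->
  (exists2 f, has_network D q f & rank f = minrankq D q) /\
  (forall f, has_network D q f -> minrankq D q <= rank f).
Proof.
move=> q2; have [f Df] := has_network_nonempty D q2.
have [|[g Dg gE] min] := @nat_minP [set rank f | f in has_network D q]%classic.
  by exists (rank f), f.
by split=> [|h Dh]; [exists g | apply: min; exists h].
Qed.

Lemma minrankP (n : nat) (D : rel 'I_n) :
  (exists2 q, 2 <= q & minrankq D q = minrank D) /\
  (forall q, 2 <= q -> minrank D <= minrankq D q).
Proof.
have [|[q q2 qE] min] :=
    @nat_minP [set minrankq D q | q in [set q | 2 <= q]]%classic.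
  by exists (minrankq D 2), 2.
by split=> [|r r2]; [exists q | apply: min; exists r].
Qed.

(** * Full conjunctive rank, and cycle unions as permutations *)

Lemma crank_full_cycles (n : nat) (D : rel 'I_n) :
  crank D = 2 ^ n -> disjoint_union_of_cycles D.
Proof.
move=> /rank_full_surj surj.
(* A preimage of the configuration whose only 0 is at v has a 0 at some
   in-neighbour of v, which cannot have another out-neighbour. *)
have priv v : exists u, [forall w, D u w == (w == v)].
  have [x /ffunP xE] := surj [ffun w => if w == v then ord0 else ord_max].
  have := xE v; rewrite !ffunE eqxx; case: ifP => // /negbT.
  rewrite negb_forall => /existsP[u]; rewrite negb_imply => /andP[Duv xu] _.
  exists u; apply/forallP => w;
  case: (w =P v) => [->|/eqP wv]; first by rewrite Duv.
  rewrite eqbF_neg; apply/negP => Duw; have := xE w; rewrite !ffunE (negPf wv).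
  case: ifP => // /forallP/(_ u).
  by rewrite Duw (negPf xu).
have {priv}[g gP] : exists g : 'I_n -> 'I_n, forall v w, D (g v) w = (w == v).
  have [g gP] := choice priv.
  by exists g => v w; have /forallP/(_ w)/eqP := gP v.
have g_inj : injective g.
  by move=> v w gvw; have := gP v v; rewrite gvw gP eqxx => /eqP.
(* By finiteness [g] is onto, so every vertex is some [g v], whose only out-neighbour is known;
   hence all arcs are determined. *)
have [h hK gK] := injF_bij g_inj.
have DE u v : D u v = (v == h u) by rewrite -{1}[u]gK gP.
move=> v; split; apply/eqP/cards1P.
  exists (g v); apply/setP=> u; rewrite !inE DE.
  by rewrite -(inj_eq g_inj) gK eq_sym.
by exists (h v); apply/setP=> w; rewrite !inE DE.
Qed.

(** In-degree one defines [s]; if [s v = s w], both [v] and [w] are out-neighbours of that vertex,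
    so out-degree one makes them equal. *)
Lemma cycles_perm (n : nat) (D : rel 'I_n) : disjoint_union_of_cycles D ->
  exists2 s : 'I_n -> 'I_n, injective s & forall u v, D u v = (u == s v).
Proof.
move=> cD.
have ex v : exists u, [set u | D u v] == [set u].
  by have [/eqP/cards1P[u ->] _] := cD v; exists u.
have [s sP] := choice ex.
have sE u v : D u v = (u == s v).
  by have /eqP/setP/(_ u) := sP v; rewrite !inE.
exists s => // v w svw.
have [_ /eqP/cards1P[z /setP zE]] := cD (s v).
have := zE v; have := zE w; rewrite !inE !sE svw eqxx.
by move=> /esym/eqP -> /esym/eqP.
Qed.

(** * Lower bound on the rank over an arbitrary alphabet *)

Section Interaction.
Variables (n q : nat) (f : config n q -> config n q).

(** The interaction graph only sees changes of a single coordinate, so [a] is turned into [b] one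
    coordinate at a time. *)
Lemma eq_on_in_nbrs (v : 'I_n) (a b : config n q) :
  (forall u, interaction_graph f u v -> a u = b u) -> f a v = f b v.
Proof.
move=> ab.
(* Hybrid configurations, running from [c 0 = a] to [c n = b]; [c i] and [c i.+1] can differ only at
   coordinate [i]. *)
pose c i : config n q := [ffun w : 'I_n => if w < i then b w else a w].
have step i : i <= n -> f (c i) v = f a v.
  elim: i => [_|i IH ltin].
    by congr (f _ _); apply/ffunP=> w; rewrite ffunE.
  rewrite -(IH (ltnW ltin)); pose u := Ordinal ltin.
  case Duv: (interaction_graph f u v).
    congr (f _ _); apply/ffunP=> w; rewrite !ffunE ltnS leq_eqVlt.
    case: eqP => [wi|_] //=.
    by rewrite wi ltnn (_ : w = u) ?ab //; apply: val_inj.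
  have [abu|abu] := eqVneq (a u) (b u).
    congr (f _ _); apply/ffunP=> w; rewrite !ffunE ltnS leq_eqVlt.
    case: eqP => [wi|_] //=.
    by rewrite wi ltnn (_ : w = u) ?abu //; apply: val_inj.
  (* Here the two hybrids differ exactly at [u], so a change of value at [v] would be an arc from
     [u] to [v]. *)
  apply/eqP; move/negbT: Duv; apply: contraNT => fne.
  apply/existsP; exists (c i.+1); apply/existsP; exists (c i).
  rewrite fne andbT; apply/forallP=> w; rewrite !ffunE ltnS.
  have [->|wu] := eqVneq w u; first by rewrite leqnn ltnn [b u == _]eq_sym abu.
  by rewrite leq_eqVlt [w == i :> nat](negPf wu) eqxx.
rewrite -(step n) //; congr (f _ _).
by apply/ffunP=> w; rewrite ffunE ltn_ord.
Qed.

Lemma rank_cycles_ge (D : rel 'I_n) :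
  disjoint_union_of_cycles D -> has_network D q f -> 2 ^ n <= rank f.
Proof.
move=> /cycles_perm[s s_inj sE] Df.
have [t sK tK] := injF_bij s_inj.
have wit v : exists ab : config n q * config n q, f ab.1 v != f ab.2 v.
  have := Df (s v) v; rewrite sE eqxx.
  by case/existsP=> a /existsP[b /andP[_ ab]]; exists (a, b).
have [w wP] := choice wit.
(* Coordinate [u] is read only by [t u], so it is copied from the witness pair of [t u], on the side
   selected by [T]. The [2 ^ n] choices of [T] then have distinct images. *)
pose x (T : {ffun 'I_n -> bool}) : config n q :=
  [ffun u => if T (t u) then (w (t u)).1 u else (w (t u)).2 u].
have xE T v : f (x T) v = if T v then f (w v).1 v else f (w v).2 v.
  rewrite -(fun_if (fun c : config n q => f c v)); apply: eq_on_in_nbrs => u.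
  by rewrite Df sE => /eqP ->; rewrite ffunE sK; case: (T v).
have inj : injective (fun T => f (x T)).
  move=> T U /ffunP TU; apply/ffunP=> v; have := TU v; have := wP v.
  by rewrite !xE; case: (T v) (U v) => [] [] // /eqP ne e; case: ne.
have -> : 2 ^ n = #|codom (fun T => f (x T))|.
  by rewrite card_codom // card_ffun card_bool card_ord.
by apply/subset_leq_card/fintype.subsetP=> _ /codomP[T ->]; exact: codom_f.
Qed.

End Interaction.

(** * Minimum ranks of unions of cycles *)

Lemma minrankq2_full_crank (n : nat) (D : rel 'I_n) :
  2 ^ n <= minrankq D 2 -> crank D = 2 ^ n.
Proof.
move=> le; apply/eqP; rewrite eqn_leq rank_le (leq_trans le) //.
have [_] := minrankqP D (leqnn 2); apply; exact: conj_network_has.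
Qed.

Lemma cycles_minrankq2 (n : nat) (D : rel 'I_n) :
  disjoint_union_of_cycles D -> minrankq D 2 = 2 ^ n.
Proof.
move=> cD; have [[f Df <-] _] := minrankqP D (leqnn 2).
by apply/eqP; rewrite eqn_leq rank_le (rank_cycles_ge cD).
Qed.

(** The binary alphabet gives the upper bound; [rank_cycles_ge], applied over the minimising
    alphabet, gives the lower one. *)
Lemma cycles_minrank (n : nat) (D : rel 'I_n) :
  disjoint_union_of_cycles D -> minrank D = 2 ^ n.
Proof.
move=> cD; have [[q q2 qE] min] := minrankP D.
apply/eqP; rewrite eqn_leq -{1}(cycles_minrankq2 cD) min //= -qE.
by have [[f Df <-] _] := minrankqP D q2; rewrite (rank_cycles_ge cD).
Qed.

(** * Degrees under isomorphism and vertex removal *)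

(** A loop counts twice, so degree 1 excludes loops. *)
Definition degree (G : digraph) (x : G) : nat := #|in_nbr x| + #|out_nbr x|.

Lemma isomorphic_degree (G H : digraph) (k : nat) : isomorphic G H ->
  (forall y : H, degree y = k) -> forall x : G, degree x = k.
Proof.
case=> h h_bij hE Hk x; rewrite -(Hk (h x)) /degree.
have h_inj := bij_inj h_bij.
have im (A : {set G}) (B : {set H}) :
    (forall y, (h y \in B) = (y \in A)) -> #|A| = #|B|.
  move=> AB; rewrite -(card_imset _ h_inj); apply: eq_card => z.
  have [h' _ h'K] := h_bij.
  by rewrite -[z]h'K mem_imset // AB.
by congr (_ + _); apply: im => y; rewrite !inE hE.
Qed.

Lemma isomorphic_card (G H : digraph) : isomorphic G H -> #|G| = #|H|.
Proof. by case=> h /bij_eq_card. Qed.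

Lemma card_remove (G : digraph) (R : {set G}) : #|remove R| = #|~: R|.
Proof. by rewrite card_sig; apply: eq_card => x; rewrite !inE. Qed.

Lemma degree_remove (G : digraph) (R : {set G}) (x : remove R) :
  (forall y, arc (val x) y || arc y (val x) -> y \notin R) ->
  degree x = degree (val x).
Proof.
move=> xR; rewrite /degree.
have im (A : {set remove R}) (B : {set G}) :
    (forall y, (val y \in B) = (y \in A)) ->
    (forall y, y \in B -> y \notin R) -> #|A| = #|B|.
  move=> AB BR; rewrite -(card_imset _ val_inj); apply: eq_card => z.
  apply/imsetP/idP => [[y yA ->]|zB]; first by rewrite AB.
  by exists (Sub z (BR z zB)); rewrite ?SubK // -AB SubK.
congr (_ + _); apply: im => y; rewrite !inE //= => a; apply: xR;
  by rewrite a ?orbT.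
Qed.

Lemma remove0_degree (G : digraph) (R : {set G}) (x : remove R) :
  R = set0 -> degree x = degree (val x).
Proof. by move=> R0; apply: degree_remove => y _; rewrite R0 inE. Qed.

Lemma degree_dipath1 (x : dipath 1) : degree x = 1.
Proof.
rewrite /degree -!sum1dep_card /= !(big_mkcond (fun i : 'I_2 => _ == _)).
by rewrite !big_ord_recl !big_ord0; case: x => [[|[|]]].
Qed.

(** * Components that are one-arc paths *)

Section Components.
Variable G : digraph.

Let linked (x y : G) : bool := arc x y || arc y x.

Lemma connect_linked_equiv :
  {in [set: G] & &, equivalence_rel (connect linked)}.
Proof.
have sym : connect_sym linked by apply: sym_connect_sym => x y; exact: orbC.
move=> x y z _ _ _; split; first exact: connect0.
by move=> /(same_connect sym) ->.
Qed.

Lemma components_partition : partition (components G) [set: G].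
Proof. exact: equivalence_partitionP connect_linked_equiv. Qed.

Lemma component_linked (K : {set G}) (x y : G) :
  K \in components G -> x \in K -> linked x y -> y \in K.
Proof.
case/imsetP=> z _ ->; rewrite !inE => zx xy.
exact: connect_trans zx (connect1 xy).
Qed.

Lemma components_dipath1_card :
  (forall K, K \in components G -> isomorphic (component_graph K) (dipath 1)) ->
  #|G| = #|components G| * 2.
Proof.
move=> iso; rewrite -cardsT; apply: card_uniform_partition components_partition.
by move=> K /iso/isomorphic_card; rewrite card_remove setCK card_ord.
Qed.

(** A component contains all neighbours of its vertices, so degrees can be computed inside it. *)
Lemma components_dipath1_degree :
  (forall K, K \in components G -> isomorphic (component_graph K) (dipath 1)) ->
  forall x : G, degree x = 1.
Proof.
move=> iso x; have /and3P[/eqP cov _ _] := components_partition.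
have : x \in cover (components G) by rewrite cov inE.
case/bigcupP=> K KG xK.
have xK' : x \notin ~: K by rewrite inE xK.
have := isomorphic_degree (iso K KG) degree_dipath1 (Sub x xK').
rewrite degree_remove SubK // => y xy.
by rewrite inE negbK (component_linked KG xK).
Qed.

(** Each vertex has a single neighbour, so the two ends of an arc form a whole component. *)
Lemma degree1_component_dipath1 : (forall x : G, degree x = 1) ->
  forall K, K \in components G -> isomorphic (component_graph K) (dipath 1).
Proof.
move=> deg1 K KG.
have uniq_link (x y z : G) : linked x y -> linked x z -> y = z.
  move=> xy xz; have : #|in_nbr x :|: out_nbr x| <= 1.
    by rewrite -(deg1 x) cardsU leq_subr.
  by move=> /card_le1_eqP; apply; rewrite !inE orbC.
(* Opposite arcs would make both the in-degree and the out-degree of [a] positive; the case [a = b]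
   rules out loops. *)
have asym (a b : G) : arc a b -> ~~ arc b a.
  move=> ab; apply/negP => ba; have := deg1 a; rewrite /degree.
  have : 0 < #|in_nbr a| by apply/card_gt0P; exists b; rewrite inE.
  have : 0 < #|out_nbr a| by apply/card_gt0P; exists b; rewrite inE.
  by case: #|in_nbr a| => [|?] //; case: #|out_nbr a| => [|?] //; rewrite addnS.
have irr (a : G) : arc a a = false by apply/negP => aa; have := asym a a aa;
  rewrite aa.
have [x [y [xy xK]]] : exists x, exists y, arc x y /\ x \in K.
  have [z zK] : exists z, z \in K.
    by case/imsetP: KG => z _ ->; exists z; rewrite !inE connect0.
  have : 0 < #|in_nbr z :|: out_nbr z|.
    rewrite card_gt0; apply/negP => /eqP/setP U0; have := deg1 z.
    rewrite /degree !eq_card0 // => w; have := U0 w; rewrite !inE;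
      by case: (arc w z) => //; case: (arc z w).
  case/card_gt0P=> w; rewrite !inE => /orP[wz|zw]; last by exists z, w.
  exists w, z; split=> //; apply: (component_linked KG zK).
  by rewrite /linked wz orbT.
have yK : y \in K by apply: (component_linked KG xK); rewrite /linked xy.
have KE : K = [set x; y].
  apply/eqP; rewrite eqEsubset subUset !sub1set xK yK !andbT.
  apply/fintype.subsetP => z zK.
  have [w _ KwE] := imsetP KG.
  have : connect linked x z.
    move: xK zK; rewrite KwE !inE => wx wz; apply: connect_trans wz.
    by rewrite (sym_connect_sym (fun a b => orbC (arc a b) (arc b a))).
  (* [x] and [y] are each other's only neighbour, so no link leaves the pair. *)
  have cl : closed linked (mem [set x; y]).
    apply: intro_closed => [|a b ab].
      by apply: sym_connect_sym => a b; exact: orbC.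
    rewrite !inE => /orP[] /eqP ae; rewrite ae in ab.
      by rewrite (uniq_link x b y) ?eqxx ?orbT // /linked xy.
    by rewrite (uniq_link y b x) ?eqxx // /linked xy orbT.
  by move=> /(closed_connect cl); rewrite !inE eqxx => <-.
have xNy : x != y by apply: contraTneq xy => <-; rewrite irr.
have KP a : a \in K -> a = x \/ a = y.
  by rewrite KE !inE => /orP[] /eqP; [left | right].
have cases (z : component_graph K) : val z = x \/ val z = y.
  by apply: KP; have := valP z; rewrite inE negbK.
have yx : arc y x = false by rewrite (negPf (asym x y xy)).
(* The tail goes to 0 and the head to 1. *)
exists (fun z => if val z == x then ord0 else ord_max).
  apply: inj_card_bij.
    move=> z t; case: (cases z) => ze; case: (cases t) => te; rewrite ze te;
      rewrite ?eqxx ?[y == x]eq_sym ?(negPf xNy) // => _;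
      by apply: val_inj; rewrite ze te.
  by rewrite card_remove setCK KE cards2 xNy card_ord.
move=> z t; rewrite -[RHS]/(arc (val z) (val t)).
case: (cases z) => ze; case: (cases t) => te;
  by rewrite ze te ?eqxx ?[y == x]eq_sym ?(negPf xNy) ?xy ?yx ?irr.
Qed.

End Components.

(** * The canonical version of a union of cycles *)

Section Canonical.
Variables (n : nat) (D : rel 'I_n).

Let inl_inj (T : Type) : injective (@inl T T). Proof. by move=> x y []. Qed.
Let inr_inj (T : Type) : injective (@inr T T). Proof. by move=> x y []. Qed.

Lemma degree_inl (u : 'I_n) :
  degree (inl u : bipartite D) = #|[set w | D u w]|.
Proof.
rewrite /degree [X in X + _]eq_card0 => [|[] w]; rewrite ?inE // add0n.
rewrite -(card_imset [set w | D u w] (@inr_inj 'I_n)).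
apply: eq_card => -[] w; rewrite !inE;
  last by rewrite mem_imset ?inE //; exact: inr_inj.
by symmetry; apply/imsetP => -[].
Qed.

Lemma degree_inr (v : 'I_n) :
  degree (inr v : bipartite D) = #|[set u | D u v]|.
Proof.
rewrite /degree [X in _ + X]eq_card0 => [|[] w]; rewrite ?inE // addn0.
rewrite -(card_imset [set u | D u v] (@inl_inj 'I_n)).
apply: eq_card => -[] w; rewrite !inE;
  first by rewrite mem_imset ?inE //; exact: inl_inj.
by symmetry; apply/imsetP => -[].
Qed.

Lemma cycles_degree1 :
  disjoint_union_of_cycles D <-> forall x : bipartite D, degree x = 1.
Proof.
split=> [cD [] v|deg1 v]; rewrite ?degree_inl ?degree_inr; try by case: (cD v).
by rewrite -degree_inl -degree_inr !deg1.
Qed.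

Lemma card_bipartite : #|bipartite D| = n * 2.
Proof. by rewrite card_sum card_ord muln2 addnn. Qed.

(** The in-neighbourhoods in D' are disjoint singletons, so only [v1 D v] itself can cover its
    in-neighbour. *)
Lemma cycles_not_redundant1 : disjoint_union_of_cycles D ->
  [set v1 D v | v : 'I_n & redundant1 D v] = set0.
Proof.
case/cycles_perm=> s s_inj sE; apply/setP=> x; rewrite inE.
apply/negP => /imsetP[v]; rewrite inE => /existsP[S /and3P[sub /eqP nbr _]] _.
have : (inl (s v) : bipartite D) \in in_nbrs S by rewrite nbr inE /= sE eqxx.
case/bigcupP=> y yS; rewrite inE.
have := fintype.subsetP sub y yS; rewrite !inE => /andP[yv /imsetP[w _ yw]].
by rewrite yw /= sE => /eqP/s_inj vw; rewrite yw vw eqxx in yv.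
Qed.

Lemma cycles_not_redundant0 : disjoint_union_of_cycles D ->
  [set x : bipartite_reduced D | redundant0 x] = set0.
Proof.
move=> cD; have R0 := cycles_not_redundant1 cD.
case/cycles_perm: cD => s s_inj sE; have [t sK tK] := injF_bij s_inj.
apply/setP=> x; rewrite !inE; apply/existsP => -[v /andP[/eqP xv red]].
(* The unique out-neighbour of [inl v] survives in D''. It shows that [x] is not isolated, and no
   other [inl u] shares it. *)
have tv : (inr (t v) : bipartite D) \notin
    [set v1 D v | v : 'I_n & redundant1 D v].
  by rewrite R0 inE.
pose y : bipartite_reduced D := Sub (inr (t v)) tv.
have xy : y \in out_nbr x by rewrite inE /= xv /= sE tK.
case/orP: red => [/andP[_ /eqP e]|]; first by rewrite e inE in xy.
case/existsP=> z /existsP[u /and3P[/eqP zu uv /eqP e]].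
by move: xy; rewrite -e inE /= zu /= sE tK => /eqP uv'; rewrite uv' ltnn in uv.
Qed.

Lemma cycles_canonical : disjoint_union_of_cycles D ->
  #|components (canonical_version D)| = n /\
  (forall K, K \in components (canonical_version D) ->
     isomorphic (component_graph K) (dipath 1)).
Proof.
move=> cD; have R1 := cycles_not_redundant1 cD.
have R0 := cycles_not_redundant0 cD.
have iso K : K \in components (canonical_version D) ->
    isomorphic (component_graph K) (dipath 1).
  move: K; apply: degree1_component_dipath1 => x; rewrite !remove0_degree //.
  by move/cycles_degree1: cD.
split=> //; apply/eqP; rewrite -(eqn_pmul2r (isT : 0 < 2)).
rewrite -components_dipath1_card // -card_bipartite.
by rewrite card_remove R0 setC0 cardsT card_remove R1 setC0 cardsT.
Qed.

Lemma canonical_cycles :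
  #|components (canonical_version D)| = n ->
  (forall K, K \in components (canonical_version D) ->
     isomorphic (component_graph K) (dipath 1)) ->
  disjoint_union_of_cycles D.
Proof.
move=> cn iso; have := components_dipath1_card iso.
rewrite cn -card_bipartite => cE.
(* The vertex counts of C(D), D'' and D' increase weakly, and the first equals the last, so both
   removals are empty. *)
have le0 : #|canonical_version D| <= #|bipartite_reduced D|.
  by rewrite card_remove max_card.
have le1 : #|bipartite_reduced D| <= #|bipartite D|.
  by rewrite card_remove max_card.
have rem0 (G : digraph) (R : {set G}) : #|G| <= #|remove R| -> R = set0.
  rewrite card_remove => le; apply/eqP; rewrite -cards_eq0 -leqn0.
  by rewrite -(leq_add2r #|~: R|) cardsC add0n.
have R1 : [set v1 D v | v : 'I_n & redundant1 D v] = set0.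
  by apply: rem0; rewrite -cE.
have R0 : [set x : bipartite_reduced D | redundant0 x] = set0.
  by apply: rem0; rewrite -/(canonical_version D) cE.
apply/cycles_degree1 => x.
have x1 : x \notin [set v1 D v | v : 'I_n & redundant1 D v] by rewrite R1 inE.
pose y : bipartite_reduced D := Sub x x1.
have y0 : y \notin [set x : bipartite_reduced D | redundant0 x].
  by rewrite R0 inE.
rewrite -(components_dipath1_degree iso (Sub y y0)).
by rewrite !remove0_degree // !SubK.
Qed.

End Canonical.

Theorem theorem3p9 (n : nat) (D : rel 'I_n) :
  [<-> crank D = 2 ^ n;
       minrankq D 2 = 2 ^ n;
       minrank D = 2 ^ n;
       disjoint_union_of_cycles D;
       #|components (canonical_version D)| = n /\
       (forall K, K \in components (canonical_version D) ->
          isomorphic (component_graph K) (dipath 1))].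
Proof.
tfae.
- by move=> /crank_full_cycles; exact: cycles_minrankq2.
- move=> m2; apply/cycles_minrank/crank_full_cycles/minrankq2_full_crank.
  by rewrite m2.
(* The minimum over all alphabets bounds the binary one from below, which forces full conjunctive
   rank. *)
- move=> m; apply/crank_full_cycles/minrankq2_full_crank; rewrite -m.
  by have [_] := minrankP D; apply.
- exact: cycles_canonical.
- move=> [cn iso]; apply/minrankq2_full_crank.
  by rewrite cycles_minrankq2 //; exact: canonical_cycles.
Qed.
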